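(* (Topological Invariance.) Let $S$ be a complete semiring, $(\mathbf{C},\otimes,I)$ a small strict monoidal category, $\mathcal{F}$ a system of fields and $\mathbb{T}$ a system of $\mathbf{C}$-valued action exponentials. If $\phi:W\to W'$ is a homeomorphism of bordisms with restriction $\phi_\partial:\partial W\to\partial W'$ to the boundary, then $\phi_{\partial *}(Z_W)=Z_{W'}$. If $W$ and $W'$ are closed, then $\phi_{\partial *}=\operatorname{id}:Q\to Q$ and thus $Z_W=Z_{W'}$.
   Context: A semiring $(S,+,\cdot,0,1)$ consists of a commutative monoid $(S,+,0)$ and a (not necessarily commutative) monoid $(S,\cdot,1)$ such that $\cdot$ distributes over $+$ from both sides and $0$ is absorbing. A complete monoid is a commutative monoid $(M,+,0)$ with a summation law assigning to every family $(m_i)_{i\in I}$, $I$ an arbitrary set, an element $\sum_{i\in I}m_i$ such that $\sum_{i\in\varnothing}m_i=0$, $\sum_{i\in\{1\}}m_i=m_1$, $\sum_{i\in\{1,2\}}m_i=m_1+m_2$, and $\sum_{j\in J}\big(\sum_{i\in I_j}m_i\big)=\sum_{i\in I}m_i$ for every partition $I=\bigcup_{j\in J}I_j$. A semiring is complete if $(S,+,0,\sum)$ is a complete monoid and $\sum_i ss_i=s\sum_i s_i$, $\sum_i s_is=(\sum_i s_i)s$. $Q=Q_S(\mathbf{C})$ is the complete monoid of functions $\operatorname{Mor}(\mathbf{C})\to S$ with pointwise addition and summation. Fix an integer $n\ge 0$. Manifolds are topological and need not be orientable; $\varnothing$ is a manifold of every dimension; $\sqcup$ is the ordered disjoint union.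 A bordism from $M$ to $N$ is a triple $(W,M,N)$ (often abbreviated $W$) with $W$ a compact $(n+1)$-dimensional topological manifold, $\partial W=M\sqcup N$, where the closed $n$-manifolds $M,N$ are the incoming and outgoing boundary. $(W,M,N)\sqcup(W',M',N')=(W\sqcup W',M\sqcup M',N\sqcup N')$. If $W'$ is a bordism from $M$ to $N$ and $W''$ a bordism from $N$ to $P$, gluing along $N$ yields the bordism $W'\cup_N W''$ from $M$ to $P$. A homeomorphism of bordisms is a homeomorphism preserving incoming and outgoing boundaries. $(W_0,M_0,N_0)$ is a subbordism of $(W,M,N)$ if $W_0\subset W$ is a codimension $0$ submanifold, every connected component $C$ of $M_0$ satisfies $C\cap\partial W=\varnothing$ or $C\subset M$, and every connected component $C$ of $N_0$ satisfies $C\cap\partial W=\varnothing$ or $C\subset N$. A system $\mathcal{F}$ of fields assigns to each bordism $W$ a set $\mathcal{F}(W)$ and to each closed $n$-manifold $M$ a set $\mathcal{F}(M)$, with $\mathcal{F}(\varnothing)$ a one-element set, such that: (FRES) There are restriction maps $\mathcal{F}(W)\to\mathcal{F}(W_0)$ for subbordisms $W_0\subset W$, $\mathcal{F}(M)\to\mathcal{F}(M_0)$ for codimension $0$ submanifolds $M_0\subset M$, and $\mathcal{F}(W)\to\mathcal{F}(M)$ for closed codimension $1$ submanifolds $M\subset W$; they are written $f\mapsto f|_{(-)}$ and commute with each other in the obvious way (restricting in stages equals restricting directly). (FHOMEO) A homeomorphism of bordisms $\phi:W\to W'$ induces a bijection $\phi^*:\mathcal{F}(W')\to\mathcal{F}(W)$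 with $(\operatorname{id}_W)^*=\operatorname{id}$, $(\psi\circ\phi)^*=\phi^*\circ\psi^*$; similarly for homeomorphisms of closed $n$-manifolds; these maps commute with the restriction maps. (FDISJ) The products of restrictions $\mathcal{F}(W\sqcup W')\to\mathcal{F}(W)\times\mathcal{F}(W')$ and $\mathcal{F}(M\sqcup N)\to\mathcal{F}(M)\times\mathcal{F}(N)$ are bijections. (FGLUE) For $W=W'\cup_N W''$, the map $\mathcal{F}(W)\to\mathcal{F}(W')\times_{\mathcal{F}(N)}\mathcal{F}(W'')$ given by the restrictions to $W'$ and $W''$ is a bijection onto the pullback. A system $\mathbb{T}$ of $\mathbf{C}$-valued action exponentials consists of functions $\mathbb{T}_W:\mathcal{F}(W)\to\operatorname{Mor}(\mathbf{C})$ for all bordisms $W$ with $\mathbb{T}_\varnothing(p)=\operatorname{id}_I$ ($p$ the unique element of $\mathcal{F}(\varnothing)$) such that: (TDISJ) $\mathbb{T}_{W\sqcup W'}(f)=\mathbb{T}_W(f|_W)\otimes\mathbb{T}_{W'}(f|_{W'})$; (TGLUE) for $W=W'\cup_NW''$, $\mathbb{T}_W(f)=\mathbb{T}_{W''}(f|_{W''})\circ\mathbb{T}_{W'}(f|_{W'})$; (THOMEO) for a homeomorphism of bordisms $\phi:W\to W'$ and $f\in\mathcal{F}(W')$, $\mathbb{T}_W(\phi^*f)=\mathbb{T}_{W'}(f)$. For a closed $n$-manifold $M$, the pre-state module is $E(M)=\operatorname{Fun}_Q(\mathcal{F}(M))$, the set of functions $\mathcal{F}(M)\to Q$; in particular $E(\varnothing)\cong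 Q$. A homeomorphism $\phi:M\to N$ of closed $n$-manifolds induces $\phi_*:E(M)\to E(N)$, $\phi_*(z)(g)=z(\phi^*g)$ for $g\in\mathcal{F}(N)$. For a bordism $W$ and $F\in\mathcal{F}(W)$, $T_W(F)\in Q$ is the characteristic function of the morphism $\mathbb{T}_W(F)$ (value $1\in S$ at $\mathbb{T}_W(F)$, $0$ elsewhere). For $f\in\mathcal{F}(\partial W)$ let $\mathcal{F}(W,f)=\{F\in\mathcal{F}(W)\mid F|_{\partial W}=f\}$. The state sum $Z_W\in E(\partial W)$ is $Z_W(f)=\sum_{F\in\mathcal{F}(W,f)}T_W(F)\in Q$, using the summation law of $Q$. *)

(* Defs.v *)
From HB Require Import structures.
From mathcomp Require Import all_boot all_order all_algebra.
From mathcomp Require Import all_classical reals topology.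

Set Implicit Arguments.
Unset Strict Implicit.
Unset Printing Implicit Defensive.

Import Order.TTheory GRing.Theory Num.Theory.
Import numFieldTopology.Exports.

Local Open Scope classical_set_scope.
Local Open Scope ring_scope.

(* An indexing set is a type. The three finite axioms are stated for every
   index type with no, one or two elements, since index sets such as the blocks
   of a partition are never literally the types [False], [unit] and [bool].
   Blocks of a partition may be empty. *)
HB.mixin Record isCompleteMonoid M of GRing.Nmodule M := {
  csum : forall I : Type, (I -> M) -> M;
  csum0 : forall (I : Type) (m : I -> M), (I -> False) -> csum I m = 0;
  csum1 : forall (I : Type) (m : I -> M) (i : I),
    (forall k, k = i) -> csum I m = m i;
  csum2 : forall (I : Type) (m : I -> M) (i j : I),
    i <> j -> (forall k, k = i \/ k = j) -> csum I m = m i + m j;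
  csum_partition : forall (I J : Type) (P : J -> set I) (m : I -> M),
    trivIset setT P -> \bigcup_j P j = setT ->
    csum J (fun j => csum (P j) (fun i => m (set_val i))) = csum I m
}.

#[short(type="completeMonoidType")]
HB.structure Definition CompleteMonoid :=
  { M of GRing.Nmodule M & isCompleteMonoid M }.

Arguments csum {s I} m : rename.

HB.mixin Record isCompleteSemiring S
    of GRing.PzSemiRing S & isCompleteMonoid S := {
  csum_mull : forall (I : Type) (s : S) (m : I -> S),
    csum (fun i => s * m i) = s * csum m;
  csum_mulr : forall (I : Type) (s : S) (m : I -> S),
    csum (fun i => m i * s) = csum m * s
}.

#[short(type="completeSemiRingType")]
HB.structure Definition CompleteSemiring :=
  { S of GRing.PzSemiRing S & isCompleteMonoid S & isCompleteSemiring S }.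

Section FunCompleteMonoid.
Variables (X : Type) (M : completeMonoidType).

Definition fun_csum (I : Type) (m : I -> X -> M) : X -> M :=
  fun x => csum (fun i => m i x).

Lemma fun_csum0 (I : Type) (m : I -> X -> M) :
  (I -> False) -> fun_csum m = 0.
Proof. by move=> I0; apply/funext => x; exact: csum0. Qed.

Lemma fun_csum1 (I : Type) (m : I -> X -> M) (i : I) :
  (forall k, k = i) -> fun_csum m = m i.
Proof. by move=> Ii; apply/funext => x; exact: csum1. Qed.

Lemma fun_csum2 (I : Type) (m : I -> X -> M) (i j : I) :
  i <> j -> (forall k, k = i \/ k = j) -> fun_csum m = m i + m j.
Proof.
by move=> ij Iij; apply/funext => x; exact: csum2.
Qed.

Lemma fun_csum_partition (I J : Type) (P : J -> set I) (m : I -> X -> M) :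
  trivIset setT P -> \bigcup_j P j = setT ->
  fun_csum (fun j => fun_csum (fun i : P j => m (set_val i))) = fun_csum m.
Proof.
move=> tP cP; apply/funext => x.
exact: (@csum_partition M I J P (fun i => m i x) tP cP).
Qed.

HB.instance Definition _ := isCompleteMonoid.Build (X -> M)
  fun_csum0 fun_csum1 fun_csum2 fun_csum_partition.

End FunCompleteMonoid.

(* The category is given by its set of all morphisms, on which strict
   associativity and unitality of the tensor product are plain equations.
   A composite [smc_comp g f h] of [g] after [f] takes a proof [h] that [g] and
   [f] are composable. *)
Record strictMonoidalCat := StrictMonoidalCat {
  smc_ob : Type;
  smc_mor : Type;
  smc_dom : smc_mor -> smc_ob;
  smc_cod : smc_mor -> smc_ob;
  smc_id : smc_ob -> smc_mor;
  smc_comp : forall g f : smc_mor, smc_dom g = smc_cod f -> smc_mor;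
  smc_dom_id : forall X, smc_dom (smc_id X) = X;
  smc_cod_id : forall X, smc_cod (smc_id X) = X;
  smc_dom_comp : forall g f (h : smc_dom g = smc_cod f),
    smc_dom (smc_comp h) = smc_dom f;
  smc_cod_comp : forall g f (h : smc_dom g = smc_cod f),
    smc_cod (smc_comp h) = smc_cod g;
  smc_comp_idl : forall X f (h : smc_dom (smc_id X) = smc_cod f),
    smc_comp h = f;
  smc_comp_idr : forall X f (h : smc_dom f = smc_cod (smc_id X)),
    smc_comp h = f;
  smc_compA : forall k g f (kg : smc_dom k = smc_cod g)
      (gf : smc_dom g = smc_cod f)
      (kg_f : smc_dom (smc_comp kg) = smc_cod f)
      (k_gf : smc_dom k = smc_cod (smc_comp gf)),
    smc_comp kg_f = smc_comp k_gf;
  smc_unit : smc_ob;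
  smc_tob : smc_ob -> smc_ob -> smc_ob;
  smc_tmor : smc_mor -> smc_mor -> smc_mor;
  smc_dom_t : forall f g,
    smc_dom (smc_tmor f g) = smc_tob (smc_dom f) (smc_dom g);
  smc_cod_t : forall f g,
    smc_cod (smc_tmor f g) = smc_tob (smc_cod f) (smc_cod g);
  smc_t_id : forall X Y,
    smc_tmor (smc_id X) (smc_id Y) = smc_id (smc_tob X Y);
  smc_t_comp : forall g f g' f' (h : smc_dom g = smc_cod f)
      (h' : smc_dom g' = smc_cod f')
      (hh' : smc_dom (smc_tmor g g') = smc_cod (smc_tmor f f')),
    smc_comp hh' = smc_tmor (smc_comp h) (smc_comp h');
  smc_tobA : forall X Y Z,
    smc_tob X (smc_tob Y Z) = smc_tob (smc_tob X Y) Z;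
  smc_tob1l : forall X, smc_tob smc_unit X = X;
  smc_tob1r : forall X, smc_tob X smc_unit = X;
  smc_tmorA : forall f g k,
    smc_tmor f (smc_tmor g k) = smc_tmor (smc_tmor f g) k;
  smc_tmor1l : forall f, smc_tmor (smc_id smc_unit) f = f;
  smc_tmor1r : forall f, smc_tmor f (smc_id smc_unit) = f
}.

Arguments smc_comp {s} g f h.
Arguments smc_unit {s}.

Section SumTopology.
Variables X Y : topologicalType.

Definition sum_nbhs (p : X + Y) : set_system (X + Y)%type :=
  match p with
  | inl x => inl @ nbhs x
  | inr y => inr @ nbhs y
  end.

HB.instance Definition _ := hasNbhs.Build (X + Y)%type sum_nbhs.

Lemma sum_nbhs_proper (p : X + Y) : ProperFilter (sum_nbhs p).
Proof. by case: p => x; exact: fmap_proper_filter. Qed.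

Lemma sum_nbhs_singleton (p : X + Y) (A : set (X + Y)) : sum_nbhs p A -> A p.
Proof. by case: p => x /=; exact: nbhs_singleton. Qed.

Lemma sum_nbhs_nbhs (p : X + Y) (A : set (X + Y)) :
  sum_nbhs p A -> sum_nbhs p (sum_nbhs^~ A).
Proof.
by case: p => x /=; rewrite /= nbhsE /= => -[U [oU Ux UA]];
  exists U => // z /= Uz; exact/(filterS UA)/open_nbhs_nbhs.
Qed.

HB.instance Definition _ := Nbhs_isNbhsTopological.Build (X + Y)%type
  sum_nbhs_proper sum_nbhs_singleton sum_nbhs_nbhs.

Lemma sum_openP (U : set (X + Y)) :
  open U <-> open (inl @^-1` U) /\ open (inr @^-1` U).
Proof.
split=> [oU|[oX oY]].
  by split; apply: open_comp => // x _ A; rewrite /nbhs /=.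
rewrite openE => -[x|y] Up; rewrite /interior /nbhs /=;
  exact: open_nbhs_nbhs.
Qed.

End SumTopology.

(* A homeomorphism onto its image: [f] is injective and the topology of [X] is
   induced by [f]. *)
Definition embedding (X Y : topologicalType) (f : X -> Y) :=
  injective f /\
  forall A : set X, open A <-> exists2 B : set Y, open B & f @^-1` B = A.

Record homeo (X Y : topologicalType) := Homeo {
  homeo_fun :> X -> Y;
  homeo_inv : Y -> X;
  homeo_cont : continuous homeo_fun;
  homeo_inv_cont : continuous homeo_inv;
  homeo_funK : cancel homeo_fun homeo_inv;
  homeo_invK : cancel homeo_inv homeo_fun
}.

Section EmbeddingTheory.

Lemma embedding_continuous (X Y : topologicalType) (f : X -> Y) :
  embedding f -> continuous f.
Proof. by move=> [_ fE]; apply/continuousP => B oB; apply/fE; exists B. Qed.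

Lemma embedding_open_map (X Y : topologicalType) (f : X -> Y) :
  injective f -> continuous f -> (forall A, open A -> open (f @` A)) ->
  embedding f.
Proof.
move=> fi fc fo; split=> // A; split=> [oA|[B oB <-]].
  exists (f @` A); first exact: fo.
  by apply/seteqP; split=> [x [y Ay /fi <-//]|x Ax]; exists x.
by move/continuousP: fc; apply.
Qed.

Lemma embedding_comp (X Y Z : topologicalType) (f : X -> Y) (g : Y -> Z) :
  embedding f -> embedding g -> embedding (g \o f).
Proof.
move=> [fi fE] [gi gE]; split=> [x y /gi/fi//|A]; split.
  by move=> /fE[B /gE[D oD <-] <-]; exists D.
by move=> [D oD <-]; apply/fE; exists (g @^-1` D) => //; apply/gE; exists D.
Qed.

Lemma embedding_set_val (X : topologicalType) (U : set X) :
  embedding (set_val : U -> X).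
Proof. by split=> [x y|A]; [exact: val_inj|split=> -[B oB <-]; exists B]. Qed.

Lemma embedding_lift (X Y Z : topologicalType) (f : X -> Y) (g : Y -> Z) :
  embedding g -> embedding (g \o f) -> embedding f.
Proof.
move=> [gi gE] [gfi gfE]; split=> [x y fxy|A]; first by apply: gfi; rewrite /= fxy.
split=> [/gfE[D oD <-]|[B /gE[D oD <-] <-]]; last by apply/gfE; exists D.
by exists (g @^-1` D) => //; apply/gE; exists D.
Qed.

Lemma inl_continuous (X Y : topologicalType) : continuous (@inl X Y).
Proof. by move=> x A; rewrite /nbhs /=. Qed.

Lemma inr_continuous (X Y : topologicalType) : continuous (@inr X Y).
Proof. by move=> x A; rewrite /nbhs /=. Qed.

Lemma inl_open_map (X Y : topologicalType) (A : set X) :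
  open A -> open (@inl X Y @` A).
Proof.
move=> oA; apply/sum_openP; split.
  by rewrite (_ : _ @^-1` _ = A)//; apply/seteqP; split=> [x [y Ay [<-]]//|x Ax];
     exists x.
by rewrite (_ : _ @^-1` _ = set0); [exact: open0|apply/seteqP; split=> // x []].
Qed.

Lemma inr_open_map (X Y : topologicalType) (A : set Y) :
  open A -> open (@inr X Y @` A).
Proof.
move=> oA; apply/sum_openP; split.
  by rewrite (_ : _ @^-1` _ = set0); [exact: open0|apply/seteqP; split=> // x []].
by rewrite (_ : _ @^-1` _ = A)//; apply/seteqP; split=> [x [y Ay [<-]]//|x Ax];
   exists x.
Qed.

Lemma inl_embedding (X Y : topologicalType) : embedding (@inl X Y).
Proof.
apply: embedding_open_map; first by move=> x y [].
  exact: inl_continuous.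
exact: inl_open_map.
Qed.

Lemma inr_embedding (X Y : topologicalType) : embedding (@inr X Y).
Proof.
apply: embedding_open_map; first by move=> x y [].
  exact: inr_continuous.
exact: inr_open_map.
Qed.

Lemma sum_hausdorff (X Y : topologicalType) :
  hausdorff_space X -> hausdorff_space Y -> hausdorff_space (X + Y)%type.
Proof.
move=> hX hY [x|y] [x'|y'] cl.
- congr inl; apply: hX => A B nA nB.
  have [||_ [[a Aa <-] [b Bb [ab]]]] := cl (inl @` A) (inl @` B).
  + by rewrite /nbhs /=; apply: filterS nA => z Az; exists z.
  + by rewrite /nbhs /=; apply: filterS nB => z Az; exists z.
  by exists a; split=> //; rewrite -ab.
- have [||_ [[a _ <-] [b _ //]]] := cl (range inl) (range inr).
  + by rewrite /nbhs /=; apply: filterE => z; exists z.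
  + by rewrite /nbhs /=; apply: filterE => z; exists z.
- have [||_ [[a _ <-] [b _ //]]] := cl (range inr) (range inl).
  + by rewrite /nbhs /=; apply: filterE => z; exists z.
  + by rewrite /nbhs /=; apply: filterE => z; exists z.
- congr inr; apply: hY => A B nA nB.
  have [||_ [[a Aa <-] [b Bb [ab]]]] := cl (inr @` A) (inr @` B).
  + by rewrite /nbhs /=; apply: filterS nA => z Az; exists z.
  + by rewrite /nbhs /=; apply: filterS nB => z Az; exists z.
  by exists a; split=> //; rewrite -ab.
Qed.

Lemma sum_compact (X Y : topologicalType) :
  compact [set: X] -> compact [set: Y] -> compact [set: X + Y].
Proof.
move=> cX cY.
have -> : [set: X + Y] = inl @` setT `|` inr @` setT.
  apply/seteqP; split=> // -[x|y] _; [left|right].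
    by exists x.
  by exists y.
apply: compactU; apply: continuous_compact => //.
  exact/continuous_subspaceT/inl_continuous.
exact/continuous_subspaceT/inr_continuous.
Qed.

Lemma sum_second_countable (X Y : topologicalType) :
  @second_countable X -> @second_countable Y ->
  @second_countable (X + Y)%type.
Proof.
move=> [B cB [oB bB]] [D cD [oD bD]].
exists ([set inl @` U | U in B] `|` [set inr @` U | U in D]).
  have -> : [set inl @` U | U in B] `|` [set inr @` U | U in D] =
      \bigcup_(b in [set: bool]) (if b then [set (@inl X Y) @` U | U in B]
                                  else [set (@inr X Y) @` U | U in D]).
    apply/seteqP; split=> [V [BV|DV]|V [[] _ h]]; [|by exists false|by left|by right].
    by exists true.
  by apply: bigcup_countable => // -[] _; exact: card_le_trans (card_image_le _ _) _.
split.
  by move=> _ [[U BU <-]|[U DU <-]]; [exact/inl_open_map/oB|exact/inr_open_map/oD].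
move=> [x|y] A; rewrite /nbhs /=.
  move=> /bB[U [BU Ux] UA]; exists (inl @` U).
    by split; [left; exists U|exists x].
  by move=> _ [z Uz <-]; exact: UA.
move=> /bD[U [BU Ux] UA]; exists (inr @` U).
  by split; [right; exists U|exists y].
by move=> _ [z Uz <-]; exact: UA.
Qed.

End EmbeddingTheory.

Section Charts.
Variable R : realType.

(* [x] has an open neighbourhood homeomorphic to a relatively open subset of
   [H]. *)
Definition locally_modelled (m : nat) (H : set 'rV[R]_m) (X : topologicalType)
    (x : X) :=
  exists (U : set X) (f : U -> 'rV[R]_m),
    [/\ open U, U x, embedding f &
        exists2 O : set 'rV[R]_m, open O & range f = O `&` H].

Definition half_space (n : nat) : set 'rV[R]_n.+1 :=
  [set v | 0 <= v ord0 ord0].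

(* the points without a Euclidean neighbourhood *)
Definition manifold_boundary (n : nat) (X : topologicalType) : set X :=
  [set x | ~ locally_modelled [set: 'rV[R]_n.+1] x].

Lemma locally_modelled_open_embedding (m : nat) (H : set 'rV[R]_m)
    (X Y : topologicalType) (e : X -> Y) (x : X) :
  embedding e -> (forall A, open A -> open (e @` A)) ->
  locally_modelled H (e x) <-> locally_modelled H x.
Proof.
move=> eE eo; have ec := embedding_continuous eE; split.
  move=> [U [f [oU Ux [fi fE] [O oO rf]]]].
  have eU (u : e @^-1` U) : U (e (set_val u)) by exact: (set_mem (valP u)).
  pose e' (u : e @^-1` U) : U := SigSub (mem_set (eU u)).
  exists (e @^-1` U), (f \o e'); split=> //.
  - by move/continuousP: ec; apply.
  - apply: (@embedding_comp _ _ _ e' f); last by split.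
    apply: (@embedding_lift _ _ _ e' (set_val : U -> Y)).
      exact: embedding_set_val.
    exact: (embedding_comp (@embedding_set_val _ _) eE).
  - have /fE[B oB fB] : open ((set_val : U -> Y) @^-1` (range e)).
      by apply/(@embedding_set_val _ U).2; exists (range e) => //; apply: eo; exact: openT.
    exists (O `&` B); first exact: openI.
    rewrite setIAC -rf; apply/seteqP; split.
      move=> _ [u _ <-]; split; first by exists (e' u).
      have /(_ (e' u)) : forall w, (f @^-1` B) w <->
          ((set_val : U -> Y) @^-1` (range e)) w by move=> w; rewrite fB.
      by case=> _; apply; exists (set_val u).
    move=> _ [[u _ <-]] Bu.
    have : (f @^-1` B) u by [].
    rewrite fB => -[z _ zu].
    have Uz : (e @^-1` U) z by rewrite /= zu; exact: (set_mem (valP u)).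
    exists (SigSub (mem_set Uz)) => //=; congr f; exact/val_inj.
move=> [U [f [oU Ux fE [O oO rf]]]].
have ei := eE.1.
have pre (v : e @` U) : exists u : U, e (set_val u) = set_val v.
  have [u Uu uv] := set_mem (valP v).
  by exists (SigSub (mem_set Uu)).
pose g (v : e @` U) : U := projT1 (cid (pre v)).
have gE v : e (set_val (g v)) = set_val v := projT2 (cid (pre v)).
exists (e @` U), (f \o g); split.
- exact: eo.
- by exists x.
- apply: (@embedding_comp _ _ _ g f) => //.
  apply: (@embedding_lift _ _ _ g (set_val : U -> X)).
    exact: embedding_set_val.
  apply: (@embedding_lift _ _ _ _ e) => //.
  rewrite (_ : e \o _ = set_val); first exact: embedding_set_val.
  exact/funext.
- exists O => //; rewrite -rf; apply/seteqP; split=> [_ [v _ <-]|_ [u _ <-]].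
    by exists (g v).
  have Vu : (e @` U) (e (set_val u)).
    by exists (set_val u) => //; exact: (set_mem (valP u)).
  exists (SigSub (mem_set Vu)) => //=; congr f; apply/val_inj/ei.
  exact: gE.
Qed.

Lemma locally_modelled_sum (m : nat) (H : set 'rV[R]_m)
    (X Y : topologicalType) :
  (forall x : X, locally_modelled H (inl x : X + Y) <-> locally_modelled H x) /\
  (forall y : Y, locally_modelled H (inr y : X + Y) <-> locally_modelled H y).
Proof.
split=> z; apply: locally_modelled_open_embedding.
- exact: inl_embedding.
- exact: inl_open_map.
- exact: inr_embedding.
- exact: inr_open_map.
Qed.

End Charts.

Arguments manifold_boundary R n X : clear implicits.
Arguments half_space R n : clear implicits.

(* A closed topological [n]-manifold, possibly empty, disconnected or
   non-orientable. *)
Record closedManifold (R : realType) (n : nat) := ClosedManifold {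
  cm_space :> topologicalType;
  cm_hausdorff : hausdorff_space cm_space;
  cm_second_countable : @second_countable cm_space;
  cm_compact : compact [set: cm_space];
  cm_chart : forall x : cm_space, locally_modelled [set: 'rV[R]_n] x
}.

(* A bordism [(W, M, N)]. The equality [∂W = M ⊔ N] is an embedding of the
   ordered disjoint union [M + N] into [W] whose image is [∂W]. *)
Record bordism (R : realType) (n : nat) (M N : closedManifold R n) := Bordism {
  b_space :> topologicalType;
  b_hausdorff : hausdorff_space b_space;
  b_second_countable : @second_countable b_space;
  b_compact : compact [set: b_space];
  b_chart : forall x : b_space, locally_modelled (half_space R n) x;
  b_incl : (M + N)%type -> b_space;
  b_incl_embedding : embedding b_incl;
  b_incl_range : range b_incl = manifold_boundary R n b_space
}.

Section Bordisms.
Variables (R : realType) (n : nat).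
Implicit Types M N P : closedManifold R n.

Definition in_incl M N (W : bordism M N) : M -> W := b_incl W \o inl.
Definition out_incl M N (W : bordism M N) : N -> W := b_incl W \o inr.

Lemma cm_sum_chart M N (x : M + N) : locally_modelled [set: 'rV[R]_n] x.
Proof.
have [ml mr] := locally_modelled_sum [set: 'rV[R]_n] M N.
by case: x => x; [apply/ml|apply/mr]; exact: cm_chart.
Qed.

Definition cm_sum M N : closedManifold R n :=
  @ClosedManifold R n (M + N)%type
    (sum_hausdorff (@cm_hausdorff _ _ M) (@cm_hausdorff _ _ N))
    (sum_second_countable (@cm_second_countable _ _ M)
      (@cm_second_countable _ _ N))
    (sum_compact (@cm_compact _ _ M) (@cm_compact _ _ N))
    (@cm_sum_chart M N).

Section Sum.
Variables (M N M' N' : closedManifold R n).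
Variables (W : bordism M N) (W' : bordism M' N').

Lemma b_sum_chart (x : W + W') : locally_modelled (half_space R n) x.
Proof.
have [ml mr] := locally_modelled_sum (half_space R n) W W'.
by case: x => x; [apply/ml|apply/mr]; exact: b_chart.
Qed.

Definition b_sum_incl (x : cm_sum M M' + cm_sum N N') : (W + W')%type :=
  match x with
  | inl (inl p) => inl (in_incl W p)
  | inl (inr p) => inr (in_incl W' p)
  | inr (inl q) => inl (out_incl W q)
  | inr (inr q) => inr (out_incl W' q)
  end.

Lemma b_sum_incl_embedding : embedding b_sum_incl.
Proof.
have [iW eW] := b_incl_embedding W; have [iW' eW'] := b_incl_embedding W'.
split.
  by move=> [[x|x]|[x|x]] [[y|y]|[y|y]] //= []; rewrite /in_incl /out_incl /=;
    (move/iW || move/iW') => // -[->].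
move=> A; split.
  move=> /sum_openP[/sum_openP[oMM oMM'] /sum_openP[oNN oNN']].
  have /eW[B oB BE] : open ([set x | match x with
      | inl p => A (inl (inl p)) | inr q => A (inr (inl q)) end] : set (M + N)).
    exact/sum_openP.
  have /eW'[B' oB' BE'] : open ([set x | match x with
      | inl p => A (inl (inr p)) | inr q => A (inr (inr q)) end] : set (M' + N')).
    exact/sum_openP.
  exists [set x | match x with inl w => B w | inr w => B' w end].
    exact/sum_openP.
  apply/seteqP; split=> [[[x|x]|[x|x]]|[[x|x]|[x|x]]] /= h.
  - by have : (b_incl W @^-1` B) (inl x) by []; rewrite BE.
  - by have : (b_incl W' @^-1` B') (inl x) by []; rewrite BE'.
  - by have : (b_incl W @^-1` B) (inr x) by []; rewrite BE.
  - by have : (b_incl W' @^-1` B') (inr x) by []; rewrite BE'.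
  - by change ((b_incl W @^-1` B) (inl x)); rewrite BE.
  - by change ((b_incl W' @^-1` B') (inl x)); rewrite BE'.
  - by change ((b_incl W @^-1` B) (inr x)); rewrite BE.
  - by change ((b_incl W' @^-1` B') (inr x)); rewrite BE'.
move=> [B /sum_openP[oB oB'] <-].
have /sum_openP[o1 o2] : open (b_incl W @^-1` (inl @^-1` B)).
  by apply/eW; exists (inl @^-1` B).
have /sum_openP[o3 o4] : open (b_incl W' @^-1` (inr @^-1` B)).
  by apply/eW'; exists (inr @^-1` B).
by apply/sum_openP; split; apply/sum_openP.
Qed.

Lemma b_sum_incl_range :
  range b_sum_incl = manifold_boundary R n (W + W')%type.
Proof.
have [ml mr] := locally_modelled_sum [set: 'rV[R]_n.+1] W W'.
have rW := b_incl_range W; have rW' := b_incl_range W'.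
apply/seteqP; split.
  move=> _ [[[x|x]|[x|x]] _ <-] /=; (move/ml || move/mr) => h.
  - by have : manifold_boundary R n W (b_incl W (inl x)) by rewrite -rW; exists (inl x).
  - by have : manifold_boundary R n W' (b_incl W' (inl x)) by rewrite -rW'; exists (inl x).
  - by have : manifold_boundary R n W (b_incl W (inr x)) by rewrite -rW; exists (inr x).
  - by have : manifold_boundary R n W' (b_incl W' (inr x)) by rewrite -rW'; exists (inr x).
move=> [w|w] h.
  have : manifold_boundary R n W w by move=> k; apply: h; exact/ml.
  by rewrite -rW => -[[p|q] _ <-]; [exists (inl (inl p))|exists (inr (inl q))].
have : manifold_boundary R n W' w by move=> k; apply: h; exact/mr.
by rewrite -rW' => -[[p|q] _ <-]; [exists (inl (inr p))|exists (inr (inr q))].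
Qed.

Definition b_sum : bordism (cm_sum M M') (cm_sum N N') :=
  @Bordism R n (cm_sum M M') (cm_sum N N') (W + W')%type
    (sum_hausdorff (@b_hausdorff _ _ _ _ W) (@b_hausdorff _ _ _ _ W'))
    (sum_second_countable (@b_second_countable _ _ _ _ W)
      (@b_second_countable _ _ _ _ W'))
    (sum_compact (@b_compact _ _ _ _ W) (@b_compact _ _ _ _ W'))
    b_sum_chart b_sum_incl b_sum_incl_embedding b_sum_incl_range.

End Sum.

(* Submanifolds are embeddings, of which literal inclusions are a special case:
   a submanifold is a subspace that is a manifold of the appropriate dimension
   (no local flatness is assumed). Inclusions of a subset of a subset then
   compose without further identifications. A [submanifold] has codimension 0,
   a [hypersurface] is a closed submanifold of codimension 1. *)
Record submanifold M0 M := Submanifold {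
  sm_incl :> M0 -> M;
  sm_embedding : embedding sm_incl
}.

Record hypersurface M0 M N (W : bordism M N) := Hypersurface {
  hs_incl :> M0 -> W;
  hs_embedding : embedding hs_incl
}.

Record subbordism M0 N0 (W0 : bordism M0 N0) M N (W : bordism M N) :=
  Subbordism {
    sb_incl :> W0 -> W;
    sb_embedding : embedding sb_incl;
    sb_in : forall p : M0,
      let C := sb_incl @` (in_incl W0 @` connected_component [set: M0] p) in
      C `&` manifold_boundary R n W = set0 \/ C `<=` range (in_incl W);
    sb_out : forall q : N0,
      let C := sb_incl @` (out_incl W0 @` connected_component [set: N0] q) in
      C `&` manifold_boundary R n W = set0 \/ C `<=` range (out_incl W)
  }.

Definition in_hypersurface M N (W : bordism M N) : hypersurface M W :=
  Hypersurface (embedding_comp (@inl_embedding M N) (b_incl_embedding W)).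

Definition out_hypersurface M N (W : bordism M N) : hypersurface N W :=
  Hypersurface (embedding_comp (@inr_embedding M N) (b_incl_embedding W)).

Definition boundary_hypersurface M N (W : bordism M N) :
    hypersurface (cm_sum M N) W :=
  @Hypersurface (cm_sum M N) M N W (b_incl W) (b_incl_embedding W).

Definition inl_submanifold M N : submanifold M (cm_sum M N) :=
  @Submanifold M (cm_sum M N) inl (@inl_embedding M N).

Definition inr_submanifold M N : submanifold N (cm_sum M N) :=
  @Submanifold N (cm_sum M N) inr (@inr_embedding M N).

Section SumSubbordism.
Variables (M N M' N' : closedManifold R n).
Variables (W : bordism M N) (W' : bordism M' N').

Lemma inl_sb_in (p : M) :
  let C := (inl : W -> b_sum W W') @`
             (in_incl W @` connected_component [set: M] p) in
  C `&` manifold_boundary R n (b_sum W W') = set0 \/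
  C `<=` range (in_incl (b_sum W W')).
Proof. by right=> _ [_ [x _ <-] <-]; exists (inl x). Qed.

Lemma inl_sb_out (q : N) :
  let C := (inl : W -> b_sum W W') @`
             (out_incl W @` connected_component [set: N] q) in
  C `&` manifold_boundary R n (b_sum W W') = set0 \/
  C `<=` range (out_incl (b_sum W W')).
Proof. by right=> _ [_ [x _ <-] <-]; exists (inl x). Qed.

Lemma inr_sb_in (p : M') :
  let C := (inr : W' -> b_sum W W') @`
             (in_incl W' @` connected_component [set: M'] p) in
  C `&` manifold_boundary R n (b_sum W W') = set0 \/
  C `<=` range (in_incl (b_sum W W')).
Proof. by right=> _ [_ [x _ <-] <-]; exists (inr x). Qed.

Lemma inr_sb_out (q : N') :
  let C := (inr : W' -> b_sum W W') @`
             (out_incl W' @` connected_component [set: N'] q) in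
  C `&` manifold_boundary R n (b_sum W W') = set0 \/
  C `<=` range (out_incl (b_sum W W')).
Proof. by right=> _ [_ [x _ <-] <-]; exists (inr x). Qed.

Definition inl_subbordism : subbordism W (b_sum W W') :=
  @Subbordism _ _ W _ _ (b_sum W W') inl (@inl_embedding W W')
    inl_sb_in inl_sb_out.

Definition inr_subbordism : subbordism W' (b_sum W W') :=
  @Subbordism _ _ W' _ _ (b_sum W W') inr (@inr_embedding W W')
    inr_sb_in inr_sb_out.

End SumSubbordism.

(* [W] is obtained by gluing [W'] and [W''] along [N]. The point set of [W] is
   the pushout, and since all spaces are compact Hausdorff, [W] then carries
   the quotient topology. *)
Record gluing M N P (W' : bordism M N) (W'' : bordism N P) (W : bordism M P) :=
  Gluing {
    gl_left : subbordism W' W;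
    gl_right : subbordism W'' W;
    gl_cover : range gl_left `|` range gl_right = setT;
    gl_meet : forall x y, gl_left x = gl_right y <->
      exists p : N, x = out_incl W' p /\ y = in_incl W'' p;
    gl_in : forall p : M, gl_left (in_incl W' p) = in_incl W p;
    gl_out : forall q : P, gl_right (out_incl W'' q) = out_incl W q
  }.

Record bord_homeo M N (W : bordism M N) M' N' (W' : bordism M' N') :=
  BordHomeo {
    bh_homeo :> homeo W W';
    bh_in : bh_homeo @` range (in_incl W) = range (in_incl W');
    bh_out : bh_homeo @` range (out_incl W) = range (out_incl W')
  }.

Section BoundaryHomeo.

Lemma b_incl_preimage M N (W : bordism M N) M' N' (W' : bordism M' N')
    (f : W -> W') :
  f @` range (in_incl W) = range (in_incl W') ->
  f @` range (out_incl W) = range (out_incl W') ->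
  forall x : M + N, exists y : M' + N', b_incl W' y = f (b_incl W x).
Proof.
move=> fin fout [p|q].
  have [y _ <-] : range (in_incl W') (f (b_incl W (inl p))).
    by rewrite -fin; exists (b_incl W (inl p)) => //; exists p.
  by exists (inl y).
have [y _ <-] : range (out_incl W') (f (b_incl W (inr q))).
  by rewrite -fout; exists (b_incl W (inr q)) => //; exists q.
by exists (inr y).
Qed.

Lemma b_incl_lift_continuous M N (W : bordism M N) (X : topologicalType)
    (g : X -> (M + N)%type) (f : X -> W) :
  continuous f -> b_incl W \o g =1 f -> continuous g.
Proof.
move=> fc gf; apply/continuousP => A.
move=> /(b_incl_embedding W).2[B oB <-].
have -> : g @^-1` (b_incl W @^-1` B) = f @^-1` B.
  by apply/funext => x; rewrite /preimage /= -gf.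
by move/continuousP: fc; apply.
Qed.

Variables (M N M' N' : closedManifold R n).
Variables (W : bordism M N) (W' : bordism M' N') (phi : bord_homeo W W').

Lemma bh_inv_in : homeo_inv phi @` range (in_incl W') = range (in_incl W).
Proof.
rewrite -(bh_in phi); apply/seteqP; split=> [_ [_ [w Ww <-] <-]|w Ww].
  by rewrite homeo_funK.
by exists (phi w); [exists w|rewrite homeo_funK].
Qed.

Lemma bh_inv_out : homeo_inv phi @` range (out_incl W') = range (out_incl W).
Proof.
rewrite -(bh_out phi); apply/seteqP; split=> [_ [_ [w Ww <-] <-]|w Ww].
  by rewrite homeo_funK.
by exists (phi w); [exists w|rewrite homeo_funK].
Qed.

Definition boundary_fun (x : cm_sum M N) : cm_sum M' N' :=
  projT1 (cid (b_incl_preimage (bh_in phi) (bh_out phi) x)).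

Definition boundary_inv (y : cm_sum M' N') : cm_sum M N :=
  projT1 (cid (b_incl_preimage bh_inv_in bh_inv_out y)).

Lemma boundary_funE (x : cm_sum M N) :
  b_incl W' (boundary_fun x) = phi (b_incl W x).
Proof. exact: (projT2 (cid (b_incl_preimage _ _ x))). Qed.

Lemma boundary_invE (y : cm_sum M' N') :
  b_incl W (boundary_inv y) = homeo_inv phi (b_incl W' y).
Proof. exact: (projT2 (cid (b_incl_preimage _ _ y))). Qed.

Lemma boundary_fun_continuous : continuous boundary_fun.
Proof.
apply: (b_incl_lift_continuous (f := phi \o b_incl W)); last exact: boundary_funE.
move=> x; apply: continuous_comp; last exact: homeo_cont.
exact: (embedding_continuous (b_incl_embedding W)).
Qed.

Lemma boundary_inv_continuous : continuous boundary_inv.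
Proof.
apply: (b_incl_lift_continuous (f := homeo_inv phi \o b_incl W'));
  last exact: boundary_invE.
move=> x; apply: continuous_comp; last exact: homeo_inv_cont.
exact: (embedding_continuous (b_incl_embedding W')).
Qed.

Lemma boundary_funK : cancel boundary_fun boundary_inv.
Proof.
move=> x; apply: (b_incl_embedding W).1.
by rewrite boundary_invE boundary_funE homeo_funK.
Qed.

Lemma boundary_invK : cancel boundary_inv boundary_fun.
Proof.
move=> y; apply: (b_incl_embedding W').1.
by rewrite boundary_funE boundary_invE homeo_invK.
Qed.

Definition boundary_homeo : homeo (cm_sum M N) (cm_sum M' N') :=
  Homeo boundary_fun_continuous boundary_inv_continuous
    boundary_funK boundary_invK.

End BoundaryHomeo.

Definition closed_bordism M N (W : bordism M N) :=
  manifold_boundary R n W = set0.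

Lemma closed_boundary_empty M N (W : bordism M N) :
  closed_bordism W -> cm_sum M N -> False.
Proof.
rewrite /closed_bordism -b_incl_range => W0 x.
have : range (b_incl W) (b_incl W x) by exists x.
by rewrite W0.
Qed.

End Bordisms.

(* The empty manifold is represented by every manifold without points. The
   functoriality and compatibility axioms are stated for maps that agree
   pointwise with the relevant identity or composite. *)
Record fieldSystem (R : realType) (n : nat) := FieldSystem {
  fieldB : forall M N : closedManifold R n, bordism M N -> Type;
  fieldM : closedManifold R n -> Type;
  fieldB_empty : forall M N (W : bordism M N), (W -> False) ->
    exists p : fieldB W, forall q, q = p;
  fieldM_empty : forall M : closedManifold R n, (M -> False) ->
    exists p : fieldM M, forall q, q = p;
  resB : forall M0 N0 (W0 : bordism M0 N0) M N (W : bordism M N),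
    subbordism W0 W -> fieldB W -> fieldB W0;
  resM : forall M0 M : closedManifold R n,
    submanifold M0 M -> fieldM M -> fieldM M0;
  resH : forall M0 M N (W : bordism M N),
    hypersurface M0 W -> fieldB W -> fieldM M0;
  resB_resB : forall M1 N1 (W1 : bordism M1 N1) M0 N0 (W0 : bordism M0 N0)
      M N (W : bordism M N) (i : subbordism W1 W0) (j : subbordism W0 W)
      (k : subbordism W1 W),
    k =1 j \o i -> forall F, resB i (resB j F) = resB k F;
  resM_resM : forall (M1 M0 M : closedManifold R n) (i : submanifold M1 M0)
      (j : submanifold M0 M) (k : submanifold M1 M),
    k =1 j \o i -> forall f, resM i (resM j f) = resM k f;
  resH_resB : forall (M1 : closedManifold R n) M0 N0 (W0 : bordism M0 N0)
      M N (W : bordism M N) (i : hypersurface M1 W0) (j : subbordism W0 W)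
      (k : hypersurface M1 W),
    k =1 j \o i -> forall F, resH i (resB j F) = resH k F;
  resM_resH : forall (M1 M0 : closedManifold R n) M N (W : bordism M N)
      (i : submanifold M1 M0) (j : hypersurface M0 W) (k : hypersurface M1 W),
    k =1 j \o i -> forall F, resM i (resH j F) = resH k F;
  pullB : forall M N (W : bordism M N) M' N' (W' : bordism M' N'),
    bord_homeo W W' -> fieldB W' -> fieldB W;
  pullM : forall M M' : closedManifold R n, homeo M M' -> fieldM M' -> fieldM M;
  pullB_bij : forall M N (W : bordism M N) M' N' (W' : bordism M' N')
      (phi : bord_homeo W W'), bijective (pullB phi);
  pullM_bij : forall (M M' : closedManifold R n) (phi : homeo M M'),
    bijective (pullM phi);
  pullB_id : forall M N (W : bordism M N) (phi : bord_homeo W W),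
    phi =1 id -> pullB phi =1 id;
  pullM_id : forall (M : closedManifold R n) (phi : homeo M M),
    phi =1 id -> pullM phi =1 id;
  pullB_comp : forall M N (W : bordism M N) M' N' (W' : bordism M' N')
      M'' N'' (W'' : bordism M'' N'') (phi : bord_homeo W W')
      (psi : bord_homeo W' W'') (chi : bord_homeo W W''),
    chi =1 psi \o phi -> pullB chi =1 pullB phi \o pullB psi;
  pullM_comp : forall (M M' M'' : closedManifold R n) (phi : homeo M M')
      (psi : homeo M' M'') (chi : homeo M M''),
    chi =1 psi \o phi -> pullM chi =1 pullM phi \o pullM psi;
  pull_resB : forall M0 N0 (W0 : bordism M0 N0) M N (W : bordism M N)
      M0' N0' (W0' : bordism M0' N0') M' N' (W' : bordism M' N')
      (i : subbordism W0 W) (i' : subbordism W0' W')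
      (phi : bord_homeo W W') (phi0 : bord_homeo W0 W0'),
    phi \o i =1 i' \o phi0 ->
    forall F, resB i (pullB phi F) = pullB phi0 (resB i' F);
  pull_resM : forall (M0 M M0' M' : closedManifold R n)
      (i : submanifold M0 M) (i' : submanifold M0' M')
      (phi : homeo M M') (phi0 : homeo M0 M0'),
    phi \o i =1 i' \o phi0 ->
    forall f, resM i (pullM phi f) = pullM phi0 (resM i' f);
  pull_resH : forall (M0 M0' : closedManifold R n) M N (W : bordism M N)
      M' N' (W' : bordism M' N')
      (i : hypersurface M0 W) (i' : hypersurface M0' W')
      (phi : bord_homeo W W') (phi0 : homeo M0 M0'),
    phi \o i =1 i' \o phi0 ->
    forall F, resH i (pullB phi F) = pullM phi0 (resH i' F);
  fdisjB : forall M N (W : bordism M N) M' N' (W' : bordism M' N'),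
    bijective (fun F : fieldB (b_sum W W') =>
      (resB (inl_subbordism W W') F, resB (inr_subbordism W W') F));
  fdisjM : forall M N : closedManifold R n,
    bijective (fun f : fieldM (cm_sum M N) =>
      (resM (inl_submanifold M N) f, resM (inr_submanifold M N) f));
  fglue : forall M N P (W' : bordism M N) (W'' : bordism N P)
      (W : bordism M P) (g : gluing W' W'' W),
    set_bij [set: fieldB W]
      [set F : fieldB W' * fieldB W'' |
         resH (out_hypersurface W') F.1 = resH (in_hypersurface W'') F.2]
      (fun F => (resB (gl_left g) F, resB (gl_right g) F))
}.

Record actionExp (R : realType) (n : nat) (C : strictMonoidalCat)
    (Fs : fieldSystem R n) := ActionExp {
  actexp : forall M N (W : bordism M N), fieldB Fs W -> smc_mor C;
  actexp_empty : forall M N (W : bordism M N), (W -> False) ->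
    forall p : fieldB Fs W, actexp p = smc_id smc_unit;
  tdisj : forall M N (W : bordism M N) M' N' (W' : bordism M' N')
      (F : fieldB Fs (b_sum W W')),
    actexp F = smc_tmor (actexp (resB (inl_subbordism W W') F))
                        (actexp (resB (inr_subbordism W W') F));
  tglue : forall M N P (W' : bordism M N) (W'' : bordism N P)
      (W : bordism M P) (g : gluing W' W'' W) (F : fieldB Fs W),
    exists h : smc_dom (actexp (resB (gl_right g) F)) =
               smc_cod (actexp (resB (gl_left g) F)),
      actexp F = smc_comp (actexp (resB (gl_right g) F))
                          (actexp (resB (gl_left g) F)) h;
  thomeo : forall M N (W : bordism M N) M' N' (W' : bordism M' N')
      (phi : bord_homeo W W') (F : fieldB Fs W'),
    actexp (pullB phi F) = actexp F
}.

Section StateSum.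
Variables (R : realType) (n : nat).
Variables (S : completeSemiRingType) (C : strictMonoidalCat).
Variables (Fs : fieldSystem R n) (T : actionExp C Fs).

Definition Qmod : completeMonoidType := (smc_mor C -> S)%type.

Definition prestate (M : closedManifold R n) : Type := fieldM Fs M -> Qmod.

Definition pushforward (M N : closedManifold R n) (phi : homeo M N)
    (z : prestate M) : prestate N := fun g => z (pullM phi g).

Definition actchar (M N : closedManifold R n) (W : bordism M N)
    (F : fieldB Fs W) : Qmod :=
  fun gamma => if `[< gamma = actexp T F >] then 1 else 0.

Definition fields_rel_boundary (M N : closedManifold R n) (W : bordism M N)
    (f : fieldM Fs (cm_sum M N)) : Type :=
  {F : fieldB Fs W | resH (boundary_hypersurface W) F = f}.

Definition state_sum (M N : closedManifold R n) (W : bordism M N) :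
    prestate (cm_sum M N) :=
  fun f => csum (fun F : fields_rel_boundary W f => actchar (sval F)).

(* The identification of [prestate M] with [Qmod] when [M] is empty. *)
Definition empty_field (M : closedManifold R n) (M0 : M -> False) :
    fieldM Fs M := projT1 (cid (fieldM_empty Fs M0)).

Definition prestate_to_Q (M : closedManifold R n) (M0 : M -> False)
    (z : prestate M) : Qmod := z (empty_field M0).

Definition Q_to_prestate (M : closedManifold R n) (q : Qmod) : prestate M :=
  fun=> q.

Lemma Q_to_prestateK (M : closedManifold R n) (M0 : M -> False) :
  cancel (@Q_to_prestate M) (prestate_to_Q M0).
Proof. by []. Qed.

Lemma prestate_to_QK (M : closedManifold R n) (M0 : M -> False) :
  cancel (prestate_to_Q M0) (@Q_to_prestate M).
Proof.
move=> z; apply/funext => f; rewrite /Q_to_prestate /prestate_to_Q.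
by congr z; rewrite (projT2 (cid (fieldM_empty Fs M0)) f).
Qed.

End StateSum.

Arguments pushforward {R n} S C {Fs M N} phi z.
Arguments state_sum {R n} S {C Fs} T {M N} W.
Arguments prestate_to_Q {R n} S C Fs {M} M0 z.
Arguments Q_to_prestate {R n} S C Fs {M} q.

(* Main.v *)
Require Import Defs.
From mathcomp Require Import all_boot all_order all_algebra.
From mathcomp Require Import all_classical reals topology.

(** A homeomorphism of bordisms pulls fields back bijectively, and by
    naturality of restriction a field on [W'] restricts to [g] on the boundary
    exactly when its pullback to [W] restricts to the pullback of [g]; the
    converse direction is where injectivity of the pullback on boundary fields
    enters. Hence pullback identifies the two index sets of the state sums
    ([pull_rel_bij]). It also preserves the summands, because action
    exponentials are homeomorphism invariant ([actchar_pull]). So everything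
    reduces to the invariance of infinite sums under a change of index set
    ([csum_reindex]). For closed bordisms the boundary carries a single field,
    and evaluating the general identity at it gives the equality in [Q]. *)

(** The summation law has no reindexing axiom: a bijection [h] is instead turned
    into the partition of its codomain into the singletons [{h j}], whose blocks
    are indexed by the domain, so that the partition axiom regroups one sum
    into the other. *)
Lemma csum_reindex {A : completeMonoidType} {I J : Type} {h : J -> I}
    (m : I -> A) :
  bijective h -> csum (fun j => m (h j)) = csum m.
Proof.
move=> [h' hK h'K].
rewrite -(@csum_partition A I J (fun j => [set h j]%classic) m).
- congr csum; apply/funext => j.
  have hj : h j \in [set h j]%classic by apply/mem_set.
  rewrite (@csum1 A _ _ (SigSub hj)) // => k.
  by apply/val_inj; exact: set_mem (valP k).
- by move=> j k _ _ [i [/= -> /(can_inj hK)]].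
- by apply/seteqP; split=> // i _; exists (h' i) => //=; rewrite h'K.
Qed.

Section PullbackOfFields.
Variables (R : realType) (n : nat).
Variables (S : completeSemiRingType) (C : strictMonoidalCat).
Variables (Fs : fieldSystem R n) (T : actionExp C Fs).
Variables (M N M' N' : closedManifold R n).
Variables (W : bordism M N) (W' : bordism M' N') (phi : bord_homeo W W').

Lemma resH_boundary_pull (F : fieldB Fs W') :
  resH (boundary_hypersurface W) (pullB phi F) =
  pullM (boundary_homeo phi) (resH (boundary_hypersurface W') F).
Proof. by apply: pull_resH => x; rewrite /= boundary_funE. Qed.

Lemma actchar_pull (F : fieldB Fs W') :
  actchar S T (pullB phi F) = actchar S T F.
Proof. by apply/funext => gamma; rewrite /actchar thomeo. Qed.

Variable g : fieldM Fs (cm_sum M' N').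

Lemma pull_relP (F : fields_rel_boundary W' g) :
  resH (boundary_hypersurface W) (pullB phi (sval F)) =
  pullM (boundary_homeo phi) g.
Proof. by rewrite resH_boundary_pull (svalP F). Qed.

Definition pull_rel (F : fields_rel_boundary W' g) :
    fields_rel_boundary W (pullM (boundary_homeo phi) g) :=
  exist _ (pullB phi (sval F)) (pull_relP F).

Lemma pull_rel_bij : bijective pull_rel.
Proof.
have [unpull pullK unpullK] := pullB_bij Fs phi.
(* The boundary value of the unpulled field is only known after pulling it
   back, so injectivity on boundary fields is what recovers [g] itself. *)
have unpullP (F : fields_rel_boundary W (pullM (boundary_homeo phi) g)) :
    resH (boundary_hypersurface W') (unpull (sval F)) = g.
  apply: (bij_inj (pullM_bij Fs (boundary_homeo phi))).
  by rewrite -resH_boundary_pull unpullK (svalP F).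
exists (fun F => exist _ (unpull (sval F)) (unpullP F)) => -[F rF];
  by apply: eq_exist => /=; rewrite ?pullK ?unpullK.
Qed.

End PullbackOfFields.

Arguments pull_rel_bij {R n Fs M N M' N' W W'} phi g.

Theorem theorem6p4 (R : realType) (n : nat)
    (S : completeSemiRingType) (C : strictMonoidalCat)
    (Fs : fieldSystem R n) (T : actionExp C Fs)
    (M N M' N' : closedManifold R n)
    (W : bordism M N) (W' : bordism M' N') (phi : bord_homeo W W') :
  pushforward S C (boundary_homeo phi) (state_sum S T W) = state_sum S T W' /\
  (forall (cW : closed_bordism W) (cW' : closed_bordism W'),
     (forall q : Qmod S C,
        prestate_to_Q S C Fs (closed_boundary_empty cW')
          (pushforward S C (boundary_homeo phi) (Q_to_prestate S C Fs q)) = q) /\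
     prestate_to_Q S C Fs (closed_boundary_empty cW) (state_sum S T W) =
     prestate_to_Q S C Fs (closed_boundary_empty cW') (state_sum S T W')).
Proof.
have invariance :
    pushforward S C (boundary_homeo phi) (state_sum S T W) = state_sum S T W'.
  apply/funext => g.
  rewrite /pushforward /state_sum -(csum_reindex _ (pull_rel_bij phi g)).
  by congr csum; apply/funext => F; exact: actchar_pull.
split=> // cW cW'; split=> //.
rewrite /prestate_to_Q -invariance; apply: (congr1 (state_sum S T W)).
(* Both arguments are fields on the empty boundary of [W]. *)
have [p pU] := fieldM_empty Fs (closed_boundary_empty cW).
exact: (etrans (pU _) (esym (pU _))).
Qed.
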